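(* Let $m,n$ be positive integers with $n$ even, and let $\mathcal{C}$ be a symmetric Cauchy tensor of order $m$ and dimension $n$ with generating vector $c\in\mathbb{R}^n$. Then $\mathcal{C}$ is skew centrosymmetric if and only if $c$ is skew symmetric, i.e. $Jc=-c$.
   Context: Write $[n]=\{1,\dots,n\}$. Given $c=(c_1,\dots,c_n)\in\mathbb{R}^n$ with $c_{i_1}+\cdots+c_{i_m}\ne0$ for all $i_1,\dots,i_m\in[n]$, the (symmetric) Cauchy tensor of order $m$ and dimension $n$ with generating vector $c$ is the real tensor $\mathcal{C}=(c_{i_1\cdots i_m})$ with entries $c_{i_1i_2\cdots i_m}=\dfrac{1}{c_{i_1}+c_{i_2}+\cdots+c_{i_m}}$. A tensor $(a_{i_1\cdots i_m})$ of order $m$ and dimension $n$ is skew centrosymmetric if $a_{i_1\cdots i_m}=-a_{n-i_1+1,\dots,n-i_m+1}$ for all indices in $[n]$. $J$ is the $n\times n$ matrix with $J_{ij}=\delta_{i,\,n-j+1}$, so $(Jc)_i=c_{n-i+1}$. *)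

(* Defs.v *)
From HB Require Import structures.
From mathcomp Require Import all_boot all_order all_algebra.
From mathcomp Require Import reals.

Set Implicit Arguments.
Unset Strict Implicit.
Unset Printing Implicit Defensive.

Import GRing.Theory.
Local Open Scope ring_scope.

(* Indices are 0-based: [rev_ord i] is n - i - 1, i.e. the map written
   i |-> n - i + 1 when indices range over {1, ..., n}. *)

Definition tensor (R : Type) (m n : nat) : Type :=
  {ffun {ffun 'I_m -> 'I_n} -> R}.

(* The nonvanishing condition is part of the notion: without it the library's
   convention 0^-1 = 0 would give entries that have no meaning. *)
Definition is_cauchy_tensor (R : realType) (m n : nat)
    (C : tensor R m n) (c : 'cV[R]_n) : Prop :=
  (forall i : {ffun 'I_m -> 'I_n}, \sum_(k < m) c (i k) 0 != 0) /\
  (forall i : {ffun 'I_m -> 'I_n}, C i = 1 / \sum_(k < m) c (i k) 0).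

Definition skew_centrosymmetric (R : realType) (m n : nat)
    (A : tensor R m n) : Prop :=
  forall i : {ffun 'I_m -> 'I_n}, A i = - A [ffun k => rev_ord (i k)].

Definition exchange_mx (R : realType) (n : nat) : 'M[R]_n :=
  \matrix_(i < n, j < n) (i == rev_ord j)%:R.

Definition skew_symmetric_vec (R : realType) (n : nat) (c : 'cV[R]_n) : Prop :=
  exchange_mx R n *m c = - c.

(* Main.v *)
(* On a constant multi-index j ... j the entry of the Cauchy tensor is
   1 / (m c_j), so skew centrosymmetry on the diagonal already forces
   c_(n-j+1) = - c_j; conversely, negating every summand negates the entry. *)
Require Import Defs.
From HB Require Import structures.
From mathcomp Require Import all_boot all_order all_algebra.
From mathcomp Require Import reals.

Set Implicit Arguments.
Unset Strict Implicit.
Unset Printing Implicit Defensive.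

Import GRing.Theory Num.Theory.
Local Open Scope ring_scope.

(** Since [rev_ord] is an involution, row [i] of J has its only nonzero entry in column
    [rev_ord i]. *)
Lemma exchange_mxE (R : realType) (n p : nat) (A : 'M[R]_(n, p)) i j :
  (exchange_mx R n *m A) i j = A (rev_ord i) j.
Proof.
rewrite mxE (bigD1 (rev_ord i)) //= mxE rev_ordK eqxx mul1r big1 ?addr0 // => k.
by rewrite mxE -(inj_eq rev_ord_inj) rev_ordK eq_sym => /negPf->; rewrite mul0r.
Qed.

Lemma skew_symmetric_vecP (R : realType) (n : nat) (c : 'cV[R]_n) :
  skew_symmetric_vec c <-> forall i, c (rev_ord i) 0 = - c i 0.
Proof.
split=> [Jc i | cN]; first by rewrite -exchange_mxE Jc mxE.
by apply/colP => i; rewrite exchange_mxE mxE cN.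
Qed.

Theorem theorem5p3 (R : realType) (m n : nat)
    (m_gt0 : (0 < m)%N) (n_gt0 : (0 < n)%N) (n_even : ~~ odd n)
    (C : tensor R m n) (c : 'cV[R]_n) (hC : is_cauchy_tensor C c) :
  skew_centrosymmetric C <-> skew_symmetric_vec c.
Proof.
have [_ CE] := hC; rewrite skew_symmetric_vecP; split=> [Cskew j | cN i].
  (* With the sign moved inside the inverse, injectivity of inversion reduces the equation to the
     denominators. *)
  have := Cskew [ffun=> j]; rewrite !CE !div1r -invrN => /invr_inj.
  under eq_bigr do rewrite ffunE.
  under [in RHS]eq_bigr do rewrite !ffunE.
  (* Both sides are now [m]-fold multiples; a positive [m] cancels in characteristic zero. *)
  rewrite !sumr_const card_ord -mulNrn => /(pmulrnI m_gt0) ->.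
  by rewrite opprK.
(* The sign passes into the inverse, then into the sum, so the denominators match term by term. *)
rewrite !CE !div1r -invrN -sumrN; congr (_^-1).
by apply: eq_bigr => k _; rewrite ffunE cN opprK.
Qed.
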